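(* Let $p$ be a prime and let $a,b$ be two positive integers. Then the function $S(n)=L_{an+b}$ is an LP function with the prime $p$ if and only if $$5F_{a}\equiv 0 \pmod p \quad\text{and}\quad L_{b}\equiv 1 \pmod p.$$
   Context: $F_n$ denotes the Fibonacci sequence: $F_0=0$, $F_1=1$, $F_n=F_{n-1}+F_{n-2}$ for $n\ge 2$. $L_n$ denotes the Lucas numbers: $L_0=2$, $L_1=1$, $L_n=L_{n-1}+L_{n-2}$ for $n\ge 2$. An arithmetic function $S:\mathbb{Z}_{\ge 0}\to\mathbb{Z}$ is an LP function with the prime $p$ if for every nonnegative integer $n=\sum_{i=0}^{r}n_i p^i$ with base-$p$ digits $0\le n_i\le p-1$, one has $S(n)\equiv S(n_0)S(n_1)\cdots S(n_r)\pmod p$.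
   Formalization: The equivalence is proved with ''S is an LP function and S is not identically 0 mod p'' on the left; without this the ''only if'' fails, e.g. p=2, a=b=3, where every L_{3n+3} is even, so S is trivially LP, but L_3=4 is not 1 mod 2. *)

(* Defs.v *)
From mathcomp Require Import all_boot all_order all_algebra.

Set Implicit Arguments.
Unset Strict Implicit.
Unset Printing Implicit Defensive.

Fixpoint fib (n : nat) : nat :=
  match n with
  | 0 => 0
  | n'.+1 => match n' with
             | 0 => 1
             | n''.+1 => fib n' + fib n''
             end
  end.

Fixpoint lucas (n : nat) : nat :=
  match n with
  | 0 => 2
  | n'.+1 => match n' with
             | 0 => 1
             | n''.+1 => lucas n' + lucas n''
             end
  end.

(* Expansions have at least one digit; leading zero digits are allowed. *)
Definition LP_function (p : nat) (S : nat -> int) : Prop :=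
  forall (n r : nat) (d : 'I_r.+1 -> nat),
    (forall i, d i < p) ->
    n = \sum_(i < r.+1) d i * p ^ i ->
    (S n = (\prod_(i < r.+1) S (d i))%R %[mod p%:Z])%Z.

(* A function that vanishes identically mod p is an [LP_function] for trivial
   reasons.  This does occur for n |-> L_(an+b), exactly when p divides both
   F_a and L_b: for instance 2 | L_(3n+3) for every n. *)
Definition vanishes_mod (p : nat) (S : nat -> int) : Prop :=
  forall n : nat, (S n = 0 %[mod p%:Z])%Z.

(* Main.v *)
(** In a field [L] of characteristic [p] containing the roots [x], [y] of
    [X^2 - X - 1], Binet's formulas hold, and Frobenius fixes or swaps [x] and
    [y].  Both directions come down to [x ^ a = y ^ a], which is equivalent to
    [5 F_a = 0].  If it holds and [L_b = 1], then [L_(an+b) = x ^ (an)] where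
    [x ^ a] is fixed by Frobenius, so this is multiplicative in the digits.
    Conversely, the values of an LP function at [0], [1], [p] and [p + 1], where
    Frobenius eliminates the exponent [p], force [x ^ a = y ^ a]. *)

Require Import Defs.
From mathcomp Require Import all_boot all_order all_algebra all_field ring.

Set Implicit Arguments.
Unset Strict Implicit.
Unset Printing Implicit Defensive.

Import GRing.Theory.
Local Open Scope ring_scope.

(** Passing to an extension of ['F_p] treats all primes uniformly, including [p = 5], where
    [X^2 - X - 1] has a double root. *)
Lemma golden_root_exists (p : nat) : prime p ->
  exists (L : fieldType) (x : L), p \in [pchar L] /\ x ^+ 2 = x + 1.
Proof.
move=> hp; pose q : {poly 'F_p} := 'X^2 - ('X + 1%:P).
have szq : size q = 3%N.
  by rewrite /q size_polyDl size_polyXn // size_polyN size_XaddC.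
have [|E [f [x qx0 _]]] := @countable_field_extension 'F_p q.
  by rewrite szq.
exists E, x; split; first by rewrite (fmorph_pchar f) pchar_Fp.
move: qx0; rewrite /q rmorphB rmorphD /= map_polyXn map_polyX map_polyC /=.
by rewrite rmorph1 rootE !hornerE subr_eq0 => /eqP.
Qed.

Lemma eqz_mod_pchar (R : nzRingType) (p : nat) (m n : int) :
  p \in [pchar R] -> (m = n %[mod p%:Z])%Z <-> m%:~R = n%:~R :> R.
Proof.
move=> pcharR; split=> [/eqP | eq_mn].
  by rewrite eqz_mod_dvd (dvdz_pcharf pcharR) intrB subr_eq0 => /eqP.
by apply/eqP; rewrite eqz_mod_dvd (dvdz_pcharf pcharR) intrB eq_mn subrr.
Qed.

Lemma eqn_mod_pchar (R : nzRingType) (p m n : nat) :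
  p \in [pchar R] -> m = n %[mod p] <-> m%:R = n%:R :> R.
Proof.
move=> pcharR; rewrite -[m%:R]/(m%:~R) -[n%:R]/(n%:~R).
rewrite -(eqz_mod_pchar _ _ pcharR) !modz_nat.
by split=> [-> | []].
Qed.

Section Binet.

Variables (R : comNzRingType) (x y : R).
Hypotheses (xyD : x + y = 1) (xyM : x * y = -1).

(** Assuming only the sum and product of the roots lets this be applied to [x ^+ p] and [y ^+ p]
    too. *)
Lemma golden_sqr : (x ^+ 2 = x + 1) * (y ^+ 2 = y + 1).
Proof.
split; apply/eqP; rewrite -subr_eq0; apply/eqP.
  by rewrite [LHS](_ : _ = x * (x + y - 1) - (x * y + 1)); [rewrite xyD xyM|]; ring.
by rewrite [LHS](_ : _ = y * (x + y - 1) - (x * y + 1)); [rewrite xyD xyM|]; ring.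
Qed.

Lemma lucas_binet n : (lucas n)%:R = x ^+ n + y ^+ n.
Proof.
suff: (lucas n)%:R = x ^+ n + y ^+ n /\ (lucas n.+1)%:R = x ^+ n.+1 + y ^+ n.+1.
  by case.
elim: n => [|n [IHn IHn1]]; first by rewrite /= !expr1 xyD !expr0.
split=> //; rewrite -[lucas n.+2]/(lucas n.+1 + lucas n)%N natrD IHn IHn1.
rewrite -(addn2 n) !exprD !golden_sqr !exprSr; ring.
Qed.

(** Kept free of division, since [x = y] in a field of characteristic 5. *)
Lemma fib_binet n : (x - y) * (fib n)%:R = x ^+ n - y ^+ n.
Proof.
suff: (x - y) * (fib n)%:R = x ^+ n - y ^+ n
      /\ (x - y) * (fib n.+1)%:R = x ^+ n.+1 - y ^+ n.+1.
  by case.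
elim: n => [|n [IHn IHn1]]; first by rewrite /= !expr1 !expr0 subrr mulr0 mulr1.
split=> //; rewrite -[fib n.+2]/(fib n.+1 + fib n)%N natrD mulrDr IHn IHn1.
rewrite -(addn2 n) !exprD !golden_sqr !exprSr; ring.
Qed.

Lemma golden_discriminant : (x - y) ^+ 2 = 5%:R.
Proof.
by rewrite [LHS](_ : _ = (x + y) ^+ 2 - 4%:R * (x * y)); [rewrite xyD xyM|]; ring.
Qed.

End Binet.

Section GoldenField.

Variables (L : fieldType) (p : nat) (x y : L).
Hypotheses (pcharL : p \in [pchar L]) (xyD : x + y = 1) (xyM : x * y = -1).

(** Frobenius is a ring morphism, so [x ^+ p] and [y ^+ p] have the same sum and product as [x] and
    [y]; hence [x ^+ p] is a root of [(T - x)(T - y)]. *)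
Lemma golden_Frobenius :
  (x ^+ p = x /\ y ^+ p = y) \/ (x ^+ p = y /\ y ^+ p = x).
Proof.
have xpypD : x ^+ p + y ^+ p = 1.
  by rewrite -!(pFrobenius_autE pcharL) -rmorphD xyD rmorph1.
have xpypM : x ^+ p * y ^+ p = -1.
  by rewrite -!(pFrobenius_autE pcharL) -rmorphM xyM rmorphN1.
have xp2 := (golden_sqr xpypD xpypM).1.
have /eqP : (x ^+ p - x) * (x ^+ p - y) = 0.
  rewrite [LHS](_ : _ = x ^+ p ^+ 2 - x ^+ p * (x + y) + x * y); last by ring.
  by rewrite xp2 xyD xyM; ring.
have yE : y = 1 - x by rewrite -xyD addrC addKr.
have ypE : y ^+ p = 1 - x ^+ p by rewrite -xpypD addrC addKr.
rewrite mulf_eq0 !subr_eq0 => /orP[] /eqP xpE; [left | right]; split=> //.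
  by rewrite ypE xpE yE.
by rewrite ypE xpE yE subKr.
Qed.

Lemma golden_expr_Frobenius a (z := x ^+ a) (w := y ^+ a) :
  (z ^+ p = z /\ w ^+ p = w) \/ (z ^+ p = w /\ w ^+ p = z).
Proof.
rewrite /z /w -!exprM !(mulnC a) !exprM.
by case: golden_Frobenius => -[-> ->]; [left | right].
Qed.

(** Here [5 F_a = (x - y)^2 F_a = (x - y)(x^a - y^a)], and a vanishing first factor also gives
    [x^a = y^a]. *)
Lemma fib5_eq0 a : (5 * fib a)%:R = 0 :> L <-> x ^+ a = y ^+ a.
Proof.
rewrite natrM -(golden_discriminant xyD xyM) expr2 -mulrA (fib_binet xyD xyM).
split=> [/eqP | ->]; last by rewrite subrr mulr0.
by rewrite mulf_eq0 !subr_eq0 => /orP[] /eqP // ->.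
Qed.

Lemma lucas_progression a b n :
  (lucas (a * n + b))%:R = (x ^+ a) ^+ n * x ^+ b + (y ^+ a) ^+ n * y ^+ b.
Proof. by rewrite (lucas_binet xyD xyM) !exprD !exprM. Qed.

Lemma golden_neq0 : (x != 0) * (y != 0).
Proof.
by apply/andP; rewrite -negb_or -mulf_eq0 xyM oppr_eq0 oner_neq0.
Qed.

End GoldenField.

(** If Frobenius fixes [z] and [w], then [s(p+1) s(0) - s(1)^2 = u v (z - w)^2]. If it swaps them,
    [s(1) - s(p) = (z - w)(u - v)]; in the remaining case [u = v],
    [s(1)^2 - s(p+1) s(0) = u^2 (z - w)^2]. *)
Lemma LP_two_term_eq (L : fieldType) (p : nat) (z w u v : L)
    (s := fun n => z ^+ n * u + w ^+ n * v) :
  u != 0 -> v != 0 ->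
  (z ^+ p = z /\ w ^+ p = w) \/ (z ^+ p = w /\ w ^+ p = z) ->
  s 0%N = 1 -> s p = s 1%N -> s p.+1 = s 1%N ^+ 2 -> z = w.
Proof.
rewrite /s !expr0 !expr1 !mul1r !exprS.
move=> u0 v0 [] [-> ->] uv1 sp sp1; apply/eqP; rewrite -subr_eq0.
  have /eqP : u * v * (z - w) ^+ 2 = 0.
    rewrite [LHS](_ : _ = (z * z * u + w * w * v) * (u + v)
                          - (z * u + w * v) ^+ 2); last by ring.
    by rewrite uv1 sp1; ring.
  by rewrite mulf_eq0 mulf_eq0 (negPf u0) (negPf v0) expf_eq0.
have /eqP : (z - w) * (u - v) = 0.
  rewrite [LHS](_ : _ = (z * u + w * v) - (w * u + z * v)); last by ring.
  by rewrite sp subrr.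
rewrite mulf_eq0 => /orP[// | /eqP /subr0_eq uv].
rewrite -{}uv in uv1 sp1.
have /eqP : u ^+ 2 * (z - w) ^+ 2 = 0.
  rewrite [LHS](_ : _ = (z * u + w * u) ^+ 2
                        - (z * w * u + w * z * u) * (u + u)); last by ring.
  by rewrite uv1 sp1; ring.
by rewrite mulf_eq0 !expf_eq0 (negPf u0).
Qed.

Lemma expr_digits (R : comNzRingType) (p r : nat) (z : R) (d : 'I_r -> nat) :
  z ^+ p = z ->
  z ^+ (\sum_(i < r) d i * p ^ i) = \prod_(i < r) z ^+ d i.
Proof.
move=> zp; have zpX i : z ^+ (p ^ i) = z.
  by elim: i => [|i IHi]; rewrite ?expr1 // expnS exprM zp.
rewrite expr_sum; apply: eq_bigr => i _.
by rewrite mulnC exprM zpX.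
Qed.

Lemma LP_function_two_digits (p : nat) (S : nat -> int) (m n : nat) :
  LP_function p S -> (m < p)%N -> (n < p)%N ->
  (S (m + n * p)%N = S m * S n %[mod p%:Z])%Z.
Proof.
move=> LP mp np.
have := LP (m + n * p)%N 1%N (fun i : 'I_2 => if i == 0 :> nat then m else n).
rewrite !big_ord_recl !big_ord0 /= expn0 expn1 muln1 addn0 mulr1.
by apply=> // i; case: ifP.
Qed.

Local Close Scope ring_scope.

Theorem theorem2 (p a b : nat) (hp : prime p) (ha : 0 < a) (hb : 0 < b) :
  LP_function p (fun n => (lucas (a * n + b))%:Z%R)
    /\ ~ vanishes_mod p (fun n => (lucas (a * n + b))%:Z%R)
  <-> 5 * fib a = 0 %[mod p] /\ lucas b = 1 %[mod p].
Proof.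
have [L [x [pcharL x2]]] := golden_root_exists hp.
pose y : L := (1 - x)%R.
have xyD : (x + y = 1)%R by rewrite /y addrC subrK.
have xyM : (x * y = -1)%R.
  by rewrite /y mulrBr mulr1 -expr2 x2 opprD addrA subrr sub0r.
pose z := (x ^+ a)%R; pose w := (y ^+ a)%R.
pose u := (x ^+ b)%R; pose v := (y ^+ b)%R.
have Frob := golden_expr_Frobenius pcharL xyD xyM a; rewrite -/z -/w in Frob.
have sE n : ((lucas (a * n + b))%:R = z ^+ n * u + w ^+ n * v)%R.
  exact: lucas_progression.
rewrite !(eqn_mod_pchar _ _ pcharL) (fib5_eq0 xyD xyM) (lucas_binet xyD xyM).
rewrite -/z -/w -/u -/v.
have s0E : ((lucas (a * 0 + b))%:R = u + v)%R by rewrite sE !expr0 !mul1r.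
split=> [[LP nvan] | [zw uv1]].
  have LP2 m n : m < p -> n < p ->
      ((lucas (a * (m + n * p) + b))%:R
       = (lucas (a * m + b))%:R * (lucas (a * n + b))%:R :> L)%R.
    move=> mp np; have := LP_function_two_digits LP mp np.
    by move/(eqz_mod_pchar _ _ pcharL); rewrite intrM.
  have p_gt0 := prime_gt0 hp; have p_gt1 := prime_gt1 hp.
  have uv1 : (u + v = 1)%R.
    have [//|uvN1] := eqVneq (u + v)%R 1%R; case: nvan => n.
    have s_eq0 m : m < p -> ((lucas (a * m + b))%:R = 0 :> L)%R.
      (* Padding [m] with a leading zero digit gives [S m = S m * S 0], while [S 0 = u + v] differs
         from 1. *)
      move=> mp; have := LP2 m 0 mp p_gt0; rewrite mul0n addn0 s0E => /eqP.
      rewrite -subr_eq0 -[X in (X - _)%R]mulr1 -mulrBr mulf_eq0 subr_eq0.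
      by rewrite [X in _ || X]eq_sym (negPf uvN1) orbF => /eqP.
    (* [S] obeys a second-order recurrence, so [S 0 = S 1 = 0] forces [S = 0] *)
    apply/(eqz_mod_pchar _ _ pcharL); rewrite -[LHS]/((_)%:R)%R.
    suff: ((lucas (a * n + b))%:R = 0 :> L /\ (lucas (a * n.+1 + b))%:R = 0 :> L)%R.
      by case.
    elim: n => [|n [IHn IHn1]]; first by split; exact: s_eq0.
    split=> //; rewrite sE.
    transitivity ((z + w) * (lucas (a * n.+1 + b))%:R
                  - z * w * (lucas (a * n + b))%:R : L)%R.
      by rewrite !sE !exprS; ring.
    by rewrite IHn IHn1 !mulr0 subrr.
  split; last by [].
  have [x0 y0] := golden_neq0 xyM.
  apply: (@LP_two_term_eq L p z w u v) => //; rewrite ?expf_neq0 -?sE //.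
  - by rewrite s0E.
  (* The digit pairs [(0, 1)] and [(1, 1)], lowest digit first, encode [p] and [p + 1]. *)
  - by have := LP2 0 1 p_gt0 p_gt1; rewrite add0n mul1n s0E uv1 mul1r.
  - by have := LP2 1 1 p_gt1 p_gt1; rewrite mul1n add1n -expr2.
have sX n : ((lucas (a * n + b))%:R = z ^+ n)%R.
  by rewrite sE -zw -mulrDr uv1 mulr1.
(* As [z = w], the swapping case also fixes [z]. *)
have zp : (z ^+ p = z)%R by case: Frob => -[-> _].
split.
  move=> n r d _ ->; apply/(eqz_mod_pchar _ _ pcharL).
  rewrite rmorph_prod /= -[LHS]/((_)%:R)%R sX (expr_digits _ zp).
  by apply: eq_bigr => i _; rewrite -sX.
move=> /(_ 0)/(eqz_mod_pchar _ _ pcharL); rewrite -[LHS]/((_)%:R)%R sX expr0.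
by move/eqP; rewrite oner_eq0.
Qed.
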